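(* Let $\bar{\mathcal S}$ be a global control semigroup. For every metric space $X$, $$smdim_{Trunc_{**}(\bar{\mathcal S})}X=m\text{-}dim_{\bar{\mathcal S}}X\quad\text{and}\quad asdim_{Trunc^{**}(\bar{\mathcal S})}X=M\text{-}dim_{\bar{\mathcal S}}X.$$ On the other hand, given a small scale control semigroup $\xi$ and a large scale control semigroup $\mathcal S$, for every metric space $X$, $$dim_{Link(\xi,\mathcal S)}X=\max\{smdim_{\xi}X,\ asdim_{\mathcal S}X\}.$$
   Context: $\mathbb R_+=[0,\infty)$. A property $P(s)$ of positive reals holds in a neighborhood of $\infty$ (resp. of $0$) if there is $s_0>0$ such that it holds for all $s\ge s_0$ (resp. $s\le s_0$). A large scale dim-control function is an increasing continuous $f:\mathbb R_+\to\mathbb R_+$ with $f(x)\ge x$ in a neighborhood of $\infty$ and $\lim_{x\to\infty}f(x)=\infty$. A small scale dim-control function is an increasing continuous $f:\mathbb R_+\to\mathbb R_+$ with $f(x)\ge x$ in a neighborhood of $0$ and $f(0)=0$. A global dim-control function is one that is both. Such a function is large scale (small scale, global) linear if it equals some linear function in a neighborhood of $\infty$ (of $0$; respectively if it is equal to a linear function in a neighborhood of $0$ and to a linear function in a neighborhood of $\infty$). A large scale (small scale, global) control semigroup is a set of large scale (small scale, global) dim-control functions containing all large scale (small scale, global) linear ones and closed under composition. $Trunc^{**}(\bar{\mathcal S})$ (resp. $Trunc_{**}(\bar{\mathcal S})$) is the large scale (resp. small scale) control semigroup of all large scale (resp. small scale) dim-control functions $g$ for which there is $f\in\bar{\mathcal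 S}$ with $g(x)=f(x)$ in a neighborhood of $\infty$ (resp. of $0$). $Link(\xi,\mathcal S)$ is the set of all continuous increasing functions $g:\mathbb R_+\to\mathbb R_+$ for which there are $g_1\in\xi$ and $g_2\in\mathcal S$ with $g=g_1$ in a neighborhood of $0$ and $g=g_2$ in a neighborhood of $\infty$; it is a global control semigroup. A family of subsets of a metric space is $s$-disjoint if $d(U,V)>s$ for any two distinct members $U,V$, and $C$-bounded if every member has diameter $\le C$. For $\mathcal S$ large scale (resp. $\xi$ small scale), $asdim_{\mathcal S}X\le n$ (resp. $smdim_\xi X\le n$) means there is $f$ in the semigroup such that for every $s$ in some neighborhood of $\infty$ (resp. of $0$) there is a cover $\mathcal U=\bigcup_{i=1}^{n+1}\mathcal U_i$ of $X$ with each $\mathcal U_i$ $s$-disjoint and $f(s)$-bounded. For $\bar{\mathcal S}$ global, $dim_{\bar{\mathcal S}}X\le n$ means there is $f\in\bar{\mathcal S}$ such that for every $s>0$ there is such a cover. In each case the dimension is the least such $n$ ($\infty$ if none). For a metric space $(X,d)$, $m\text{-}dim_{\bar{\mathcal S}}X:=dim_{\bar{\mathcal S}}(X,\min(d,1))$ and $M\text{-}dim_{\bar{\mathcal S}}X:=dim_{\bar{\mathcal S}}(X,\max(d,1))$, where $\max(d,1)$ is understood to be $0$ on pairs of equal points. *)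

(* Defs.v *)
From HB Require Import structures.
From mathcomp Require Import all_boot all_order all_algebra.
From mathcomp Require Import all_classical all_reals all_analysis.

Set Implicit Arguments.
Unset Strict Implicit.
Unset Printing Implicit Defensive.

Import Order.TTheory GRing.Theory Num.Theory.
Import numFieldTopology.Exports numFieldNormedType.Exports.

Local Open Scope classical_set_scope.
Local Open Scope ring_scope.

Section control_functions.
Context {R : realType}.
Implicit Types (P : R -> Prop) (f g : R -> R) (S xi : set (R -> R)).

Definition near_zero P := exists2 s0 : R, 0 < s0 & forall s, 0 < s -> s <= s0 -> P s.
Definition near_infty P := exists2 s0 : R, 0 < s0 & forall s, s0 <= s -> P s.

(* A function from [0, +oo[ to itself is represented by any f : R -> R that
   extends it; only the values on [0, +oo[ are constrained or used. Increasing
   means strictly increasing. *)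
Definition increasing_continuous f :=
  [/\ forall x, 0 <= x -> 0 <= f x,
      forall x y, 0 <= x -> x < y -> f x < f y &
      {within `[0, +oo[, continuous f}].

Definition large_scale_control f :=
  [/\ increasing_continuous f,
      near_infty (fun x => x <= f x) &
      f x @[x --> +oo] --> +oo].

Definition small_scale_control f :=
  [/\ increasing_continuous f, near_zero (fun x => x <= f x) & f 0 = 0].

Definition global_control f := large_scale_control f /\ small_scale_control f.

(* Linear functions are the homogeneous ones x |-> c x, which is the weaker
   closure requirement on semigroups compared with x |-> c x + b. *)
Definition linear_near_infty f := exists c : R, near_infty (fun x => f x = c * x).
Definition linear_near_zero f := exists c : R, near_zero (fun x => f x = c * x).

Definition control_semigroup (control linear : set (R -> R)) S :=
  [/\ S `<=` control,
      control `&` linear `<=` S &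
      forall f g, S f -> S g -> S (f \o g)].

Definition large_scale_semigroup S :=
  control_semigroup large_scale_control linear_near_infty S.
Definition small_scale_semigroup S :=
  control_semigroup small_scale_control linear_near_zero S.
Definition global_semigroup S :=
  control_semigroup global_control (linear_near_zero `&` linear_near_infty) S.

Definition Trunc_large S : set (R -> R) :=
  [set g | large_scale_control g /\
           exists2 f, S f & near_infty (fun x => g x = f x)].

Definition Trunc_small S : set (R -> R) :=
  [set g | small_scale_control g /\
           exists2 f, S f & near_zero (fun x => g x = f x)].

Definition Link xi S : set (R -> R) :=
  [set g | [/\ increasing_continuous g,
      exists2 g1, xi g1 & near_zero (fun x => g x = g1 x) &
      exists2 g2, S g2 & near_infty (fun x => g x = g2 x)]].

End control_functions.

Section dimension.
Context {R : realType} (X : metricType R).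
Implicit Types (A B : set X) (F : set (set X)) (S : set (R -> R)) (n : nat).

(* Distances to the empty set are +oo, and the diameter of the empty set
   is -oo; the latter is only ever compared with nonnegative reals. *)
Definition set_dist A B : \bar R :=
  ereal_inf [set (mdist x y)%:E | x in A & y in B].
Definition diam A : \bar R :=
  ereal_sup [set (mdist x y)%:E | x in A & y in A].

Definition disjoint_family (s : R) F :=
  forall A B, F A -> F B -> A <> B -> (s%:E < set_dist A B)%E.
Definition bounded_family (C : R) F := forall A, F A -> (diam A <= C%:E)%E.

Definition has_cover n (s C : R) := exists U : 'I_n.+1 -> set (set X),
  (forall x, exists i, exists2 A, U i A & A x) /\
  (forall i, disjoint_family s (U i) /\ bounded_family C (U i)).

Definition asdim_le S n :=
  exists2 f, S f & near_infty (fun s => has_cover n s (f s)).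
Definition smdim_le S n :=
  exists2 f, S f & near_zero (fun s => has_cover n s (f s)).
Definition dim_le S n :=
  exists2 f, S f & forall s, 0 < s -> has_cover n s (f s).

(* The infimum of a set of naturals in \bar R is its least element, or +oo if
   the set is empty. *)
Definition least_nat (P : nat -> Prop) : \bar R :=
  ereal_inf [set n%:R%:E | n in P].

Definition asdim S := least_nat (asdim_le S).
Definition smdim S := least_nat (smdim_le S).
Definition control_dim S := least_nat (dim_le S).

End dimension.

(* X with the metrics min(d, 1) and max(d, 1), as aliases of its carrier. *)
Definition min_metric {R : realType} (X : metricType R) : Type := X.
Definition max_metric {R : realType} (X : metricType R) : Type := X.

Section truncated_metrics.
Context {R : realType} (X : metricType R).
Implicit Types x y z : X.

Definition min_dist x y : R := Num.min (mdist x y) 1.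
Definition max_dist x y : R := if x == y then 0 else Num.max (mdist x y) 1.

Lemma min_distxx x : min_dist x x = 0.
Proof. by rewrite /min_dist mdistxx min_l. Qed.

Lemma min_dist_positivity x y : min_dist x y = 0 -> x = y.
Proof.
rewrite /min_dist; case: leP => [_|_ /eqP]; last by rewrite oner_eq0.
exact: mdist_positivity.
Qed.

Lemma min_dist_sym x y : min_dist x y = min_dist y x.
Proof. by rewrite /min_dist metric_sym. Qed.

Lemma min_dist_triangle y x z : min_dist x z <= min_dist x y + min_dist y z.
Proof.
have := metric_triangle x y z; rewrite /min_dist.
have := mdist_ge0 x y; have := mdist_ge0 y z.
move: (mdist x y) (mdist y z) (mdist x z) => a b c b0 a0 abc.
rewrite ge_min; apply/orP.
case: (leP a 1) => a1; case: (leP b 1) => b1.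
- by left.
- by right; rewrite lerDr.
- by right; rewrite lerDl.
- by right; rewrite lerDl ler01.
Qed.

Lemma max_distxx x : max_dist x x = 0.
Proof. by rewrite /max_dist eqxx. Qed.

Lemma max_dist_positivity x y : max_dist x y = 0 -> x = y.
Proof.
rewrite /max_dist; case: eqVneq => // _ e.
have : 1 <= Num.max (mdist x y) (1 : R) by rewrite le_max lexx orbT.
by rewrite e ler10.
Qed.

Lemma max_dist_sym x y : max_dist x y = max_dist y x.
Proof. by rewrite /max_dist eq_sym metric_sym. Qed.

Lemma max_dist_triangle y x z : max_dist x z <= max_dist x y + max_dist y z.
Proof.
have m0 u v : 0 <= max_dist u v.
  by rewrite /max_dist; case: ifP => // _; rewrite le_max mdist_ge0.
case: (eqVneq x y) => [->|xy]; first by rewrite max_distxx add0r.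
case: (eqVneq y z) => [<-|yz]; first by rewrite max_distxx addr0.
case: (eqVneq x z) => [->|xz]; first by rewrite max_distxx addr_ge0.
rewrite /max_dist (negbTE xy) (negbTE yz) (negbTE xz) ge_max; apply/andP; split.
  by apply: (le_trans (metric_triangle x y z)); rewrite lerD// le_max lexx.
by rewrite -[leLHS]addr0 lerD// le_max ?lexx ?orbT// mdist_ge0.
Qed.

HB.instance Definition _ := Choice.on (min_metric X).
HB.instance Definition _ := @isMetric.Build R (min_metric X)
  min_dist min_distxx min_dist_positivity min_dist_sym min_dist_triangle.

HB.instance Definition _ := Choice.on (max_metric X).
HB.instance Definition _ := @isMetric.Build R (max_metric X)
  max_dist max_distxx max_dist_positivity max_dist_sym max_dist_triangle.

Lemma mdist_minE (x y : min_metric X) :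
  mdist x y = Num.min (@mdist R X x y) 1.
Proof. by []. Qed.

Lemma mdist_maxE (x y : max_metric X) :
  mdist x y = if x == y then 0 else Num.max (@mdist R X x y) 1.
Proof. by []. Qed.

End truncated_metrics.

Definition m_dim {R : realType} (X : metricType R) (S : set (R -> R)) :=
  control_dim (min_metric X) S.
Definition M_dim {R : realType} (X : metricType R) (S : set (R -> R)) :=
  control_dim (max_metric X) S.

(* Main.v *)
(** Scaling: every control semigroup is closed under [f |-> c f] for [c >= 1],
    so a control function can be made as large as needed at one prescribed
    scale without decreasing it anywhere.

    For [min(d, 1)] the large scales are covered by the whole space, of diameter
    at most [1]; for [max(d, 1)] the scales below [1] are covered by the
    singletons. On the remaining scales the covers for [d] and for the truncated
    metric are the same. For the link, the two control functions are joined by a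
    linear interpolation, the one at infinity being scaled so that the result is
    increasing, the one at zero so that the scales in between are controlled by
    the cover of a single large scale. *)

Require Import Defs.
From mathcomp Require Import all_boot all_order all_algebra.
From mathcomp Require Import all_classical all_reals all_analysis.
From mathcomp Require Import ring lra.

Import Order.TTheory GRing.Theory Num.Theory.
Import numFieldTopology.Exports numFieldNormedType.Exports.

Local Open Scope classical_set_scope.
Local Open Scope ring_scope.

(** * Least elements of sets of naturals *)

(** Upward closure puts [maxn p q] in both sets as soon as [p] is in the first and [q] in the
    second; the reverse inequality is monotonicity of the infimum. This turns a conjunction of
    dimension bounds into a maximum of dimensions. *)
Lemma least_nat_setI (R : realType) (P Q : nat -> Prop) :
  (forall m n, (m <= n)%N -> P m -> P n) ->
  (forall m n, (m <= n)%N -> Q m -> Q n) ->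
  least_nat (fun n => P n /\ Q n) = maxe (least_nat P) (least_nat Q) :> \bar R.
Proof.
move=> Pup Qup; apply/eqP; rewrite eq_le; apply/andP; split; last first.
  rewrite ge_max; apply/andP; split;
    by apply: ereal_inf_le_tmp => _ [n [Pn Qn] <-]; exists n.
rewrite leNgt; apply/negP; rewrite gt_max => /andP[].
move=> /ereal_inf_lt[_ [p Pp <-] pL] /ereal_inf_lt[_ [q Qq <-] qL].
have : (least_nat (fun n => P n /\ Q n) <= ((maxn p q)%:R : R)%:E)%E.
  apply: ereal_inf_lbound; exists (maxn p q) => //.
  by split; [apply: Pup Pp; rewrite leq_maxl|apply: Qup Qq; rewrite leq_maxr].
by rewrite /maxn; case: ifP => _; rewrite leNgt ?pL ?qL.
Qed.

Lemma least_nat_ext (R : realType) (P Q : nat -> Prop) :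
  (forall n, P n <-> Q n) -> least_nat P = least_nat Q :> \bar R.
Proof. by move=> PQ; congr least_nat; apply/funext => n; apply/propext. Qed.

(** * Pointwise forms of boundedness and disjointness; transport of covers *)

Lemma diam_leP {R : realType} (X : metricType R) (A : set X) (C : R) :
  (diam A <= C%:E)%E <-> forall x y, A x -> A y -> mdist x y <= C.
Proof.
split=> [AC x y Ax Ay|AC].
  rewrite -lee_fin; apply: le_trans AC; apply: ereal_sup_ubound.
  by exists x => //; exists y.
by apply: ge_ereal_sup => _ [x Ax] [y Ay] <-; rewrite lee_fin AC.
Qed.

(** The infimum over pairs may equal [s] although every distance exceeds [s], so the pointwise form
    needs a uniform margin [t]. *)
Lemma lt_set_distP {R : realType} (X : metricType R) (A B : set X) (s : R) :
  (s%:E < set_dist A B)%E <->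
  exists2 t, s < t & forall x y, A x -> B y -> t <= mdist x y.
Proof.
split=> [sAB|[t st tAB]]; last first.
  apply: (@lt_le_trans _ _ t%:E); first by rewrite lte_fin.
  by apply: le_ereal_inf_tmp => _ [x Ax] [y By] <-; rewrite lee_fin tAB.
have lbAB x y : A x -> B y -> (set_dist A B <= (mdist x y)%:E)%E.
  by move=> Ax By; apply: ereal_inf_lbound; exists x => //; exists y.
move: (set_dist A B) sAB lbAB => [r| |] //.
  by rewrite lte_fin => sr lbAB; exists r => // x y Ax /(lbAB x y Ax).
(* At distance [+oo] there is no pair of points at all, so any margin serves. *)
move=> _ lbAB; exists (s + 1); first by rewrite ltrDl.
by move=> x y Ax /(lbAB x y Ax).
Qed.

(* [phi] will always be the identity between two metrics on one carrier. *)
Lemma has_cover_preimage {R : realType} (X Y : metricType R) (phi : Y -> X)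
    (n : nat) (s s' C C' : R) :
  (forall t, s < t -> exists2 t', s' < t' &
     forall x y, t <= mdist (phi x) (phi y) -> t' <= mdist x y) ->
  (forall x y, mdist (phi x) (phi y) <= C -> mdist x y <= C') ->
  has_cover X n s C -> has_cover Y n s' C'.
Proof.
move=> phis phiC [U [Ucov Uprop]].
exists (fun i => [set phi @^-1` A | A in U i]); split=> [x|i].
  have [i [A UA Ax]] := Ucov (phi x).
  by exists i, (phi @^-1` A) => //; exists A.
have [Ud Ub] := Uprop i; split=> [_ _ [A UA <-] [B UB <-] AB|_ [A UA <-]].
  have /lt_set_distP[t st tAB] : (s%:E < set_dist A B)%E.
    by apply: Ud => // eAB; apply: AB; rewrite eAB.
  have [t' st' tt'] := phis t st; apply/lt_set_distP; exists t' => // x y Ax By.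
  exact/tt'/tAB.
by apply/diam_leP => x y Ax Ay; apply: phiC; move/diam_leP: (Ub A UA); apply.
Qed.

(** * Covers: monotonicity, extreme cases and truncated metrics *)

Section covers.
Context {R : realType}.
Implicit Types (X : metricType R) (n : nat).

Lemma has_cover_le X n (s s' C C' : R) :
  s' <= s -> C <= C' -> has_cover X n s C -> has_cover X n s' C'.
Proof.
move=> ss CC; apply: (@has_cover_preimage _ X X idfun) => [t st|x y /= xy].
  by exists t => //; exact: le_lt_trans st.
exact: le_trans CC.
Qed.

Lemma has_cover_dim_le X m n (s C : R) :
  (m <= n)%N -> has_cover X m s C -> has_cover X n s C.
Proof.
move=> mn [U [Ucov Uprop]].
have inordK (i : 'I_m.+1) : inord (inord i : 'I_n.+1) = i.
  by rewrite inordK ?inord_val// (leq_trans (ltn_ord i)).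
(* [inord] sends the indices beyond [m] to [ord0], so the extra families repeat the first one. *)
exists (fun i => U (inord i)); split=> [x|i]; last exact: Uprop.
have [i [A UA Ax]] := Ucov x.
by exists (inord i), A => //; rewrite inordK.
Qed.

Lemma has_cover_setT X n (s C : R) :
  (forall x y : X, mdist x y <= C) -> has_cover X n s C.
Proof.
move=> XC; exists (fun=> [set setT]); split=> [x|_].
  by exists ord0, setT.
split=> [A B -> ->//|A ->]; apply/diam_leP => x y _ _; exact: XC.
Qed.

Lemma has_cover_singletons X n (s t C : R) :
  s < t -> (forall x y : X, x <> y -> t <= mdist x y) -> 0 <= C ->
  has_cover X n s C.
Proof.
move=> st Xt C0; exists (fun=> range set1); split=> [x|_].
  by exists ord0, [set x] => //; exists x.
split=> [_ _ [x _ <-] [y _ <-] xy|_ [x _ <-]].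
  apply/lt_set_distP; exists t => // _ _ -> ->; apply: Xt => e.
  by apply: xy; rewrite e.
by apply/diam_leP => _ _ -> ->; rewrite mdistxx.
Qed.

Lemma asdim_le_up X (S : set (R -> R)) m n :
  (m <= n)%N -> asdim_le X S m -> asdim_le X S n.
Proof.
move=> mn [f Sf [s0 s00 cov]]; exists f => //; exists s0 => // s ss0.
exact/(has_cover_dim_le _ _ _ _ _ mn)/cov.
Qed.

Lemma smdim_le_up X (S : set (R -> R)) m n :
  (m <= n)%N -> smdim_le X S m -> smdim_le X S n.
Proof.
move=> mn [f Sf [s0 s00 cov]]; exists f => //; exists s0 => // s sp ss0.
exact/(has_cover_dim_le _ _ _ _ _ mn)/cov.
Qed.

(** Comparing a distance with a number below 1 gives the same answer for d and min(d, 1). *)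
Lemma has_cover_minP X n (s C : R) : s < 1 -> C < 1 ->
  has_cover (min_metric X) n s C <-> has_cover X n s C.
Proof.
move=> s1 C1; split.
  apply: (@has_cover_preimage _ (min_metric X) X idfun) => [t st|x y].
    by exists t => // x y; rewrite mdist_minE le_min => /andP[].
  by rewrite mdist_minE ge_min => /orP[//|]; rewrite leNgt C1.
apply: (@has_cover_preimage _ X (min_metric X) idfun) => [t st|x y xy].
  (* The margin may exceed 1, a value that min(d, 1) never passes; cut at 1 it is still above
     [s]. *)
  exists (Num.min t 1); first by rewrite lt_min st.
  by move=> x y xy; rewrite mdist_minE le_min !ge_min lexx xy orbT.
by rewrite mdist_minE ge_min xy.
Qed.

(** Comparing a distance with a number at least 1 gives the same answer for d and max(d, 1); equal
    points are at distance 0 in both. *)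
Lemma has_cover_maxP X n (s C : R) : 1 <= s -> 1 <= C ->
  has_cover (max_metric X) n s C <-> has_cover X n s C.
Proof.
move=> s1 C1; split.
  apply: (@has_cover_preimage _ (max_metric X) X idfun) => [t st|x y].
    have t1 : 1 < t by exact: le_lt_trans st.
    exists t => // x y; rewrite mdist_maxE /=; case: eqP => _.
      by rewrite leNgt (lt_trans ltr01).
    by rewrite le_max => /orP[//|]; rewrite leNgt t1.
  rewrite mdist_maxE /=; case: eqP => [-> C0|_]; first by rewrite mdistxx.
  by rewrite ge_max => /andP[].
apply: (@has_cover_preimage _ X (max_metric X) idfun) => [t st|x y xy].
  exists t => // x y /= txy; rewrite mdist_maxE; case: eqP => [xy|_].
    move: txy; rewrite xy mdistxx leNgt (lt_trans _ st)//.
    exact: lt_le_trans s1.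
  by rewrite le_max txy.
rewrite mdist_maxE; case: eqP => _; first exact: le_trans C1.
by rewrite ge_max xy.
Qed.

End covers.

(** * Control functions: scaling, smallness near 0 and interpolation *)

Section control_functions.
Context {R : realType}.
Implicit Types (f g : R -> R) (S xi : set (R -> R)).

Lemma increasing_continuous_linear (c : R) : 0 < c ->
  increasing_continuous ( *%R c).
Proof.
move=> c0; split=> [x x0|x y _ xy|]; first by rewrite mulr_ge0// ltW.
  by rewrite ltr_pM2l.
exact/continuous_subspaceT/mulrl_continuous.
Qed.

Lemma increasing_continuous_gt0 f x :
  increasing_continuous f -> 0 < x -> 0 < f x.
Proof.
by move=> [f0 fi _] x0; apply: (@le_lt_trans _ _ (f 0)); rewrite ?f0 ?fi.
Qed.

Lemma increasing_continuous_le f x y :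
  increasing_continuous f -> 0 <= x -> x <= y -> f x <= f y.
Proof.
by move=> [_ fi _] x0; rewrite le_eqVlt => /predU1P[->//|xy]; rewrite ltW ?fi.
Qed.

Lemma large_scale_control_linear (c : R) : 1 <= c ->
  large_scale_control ( *%R c).
Proof.
move=> c1; have c0 : 0 < c by exact: lt_le_trans c1.
split; first exact: increasing_continuous_linear.
  by exists 1 => // x x1; rewrite ler_peMl// (le_trans ler01).
exact: (gt0_cvgMry c0).
Qed.

Lemma small_scale_control_linear (c : R) : 1 <= c ->
  small_scale_control ( *%R c).
Proof.
move=> c1; have c0 : 0 < c by exact: lt_le_trans c1.
split; [exact: increasing_continuous_linear| |by rewrite mulr0].
by exists 1 => // x x0 _; rewrite ler_peMl// ltW.
Qed.

Lemma near_infty_linear (c : R) : linear_near_infty ( *%R c).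
Proof. by exists c, 1. Qed.

Lemma near_zero_linear (c : R) : linear_near_zero ( *%R c).
Proof. by exists c, 1. Qed.

Lemma large_scale_semigroupZ S f (c : R) : large_scale_semigroup S ->
  1 <= c -> S f -> S (fun x => c * f x).
Proof.
move=> [_ linS compS] c1 Sf; apply: (compS ( *%R c)) => //; apply: linS.
by split; [exact: large_scale_control_linear|exact: near_infty_linear].
Qed.

Lemma small_scale_semigroupZ S f (c : R) : small_scale_semigroup S ->
  1 <= c -> S f -> S (fun x => c * f x).
Proof.
move=> [_ linS compS] c1 Sf; apply: (compS ( *%R c)) => //; apply: linS.
by split; [exact: small_scale_control_linear|exact: near_zero_linear].
Qed.

Lemma global_semigroupZ S f (c : R) : global_semigroup S ->
  1 <= c -> S f -> S (fun x => c * f x).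
Proof.
move=> [_ linS compS] c1 Sf; apply: (compS ( *%R c)) => //; apply: linS.
split; split; first exact: large_scale_control_linear.
- exact: small_scale_control_linear.
- exact: near_zero_linear.
- exact: near_infty_linear.
Qed.

Lemma scale_above f (a b : R) : 0 < f a ->
  exists2 c, 1 <= c & b <= c * f a.
Proof.
move=> fa0; exists (Num.max 1 (b / f a)); first by rewrite le_max lexx.
by rewrite -ler_pdivrMr// le_max lexx orbT.
Qed.

Lemma small_scale_control_lt f (e : R) : small_scale_control f -> 0 < e ->
  near_zero (fun x => f x < e).
Proof.
move=> [[f0 fi fc] _ f00] e0.
have /subspace_continuousP /(_ 0) := fc.
rewrite /= in_itv /= lexx => /(_ isT) /cvgrPdist_lt /(_ e e0).
(* Continuity gives a strict bound on [s], [near_zero] asks for a non-strict one; hence the half. *)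
rewrite near_withinE => -[d /= d0 fd]; exists (d / 2); first exact: divr_gt0.
move=> s s0 sd; have := fd s; rewrite /from_subspace /= f00 !sub0r !normrN.
rewrite in_itv /= andbT (ger0_norm (ltW s0)).
have -> : s < d.
  by apply: le_lt_trans sd _; rewrite ltr_pdivrMr// ltr_pMr// ltr1n.
move=> /(_ isT (ltW s0)); exact/le_lt_trans/ler_norm.
Qed.

(* [f] need not be continuous on the negative reals. *)
Lemma continuous_max0 f : increasing_continuous f ->
  continuous (fun x : R => f (Num.max x 0)).
Proof.
move=> [_ _ /subspace_continuousP fc] x.
have mc : {for x, continuous (fun y : R => Num.max y 0)}.
  by apply: continuous_max; [exact: cvg_id|exact: cvg_cst].
have x0 : `[0, +oo[%classic (Num.max x 0).
  by rewrite /= in_itv /= le_max lexx orbT.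
(* The clamped argument never leaves the half-line, so the limit of [f] within it is enough. *)
apply: cvg_comp (fc _ x0) => A /mc; apply: (@filterS _ (nbhs x)) => y /=.
by apply; rewrite /= in_itv /= le_max lexx orbT.
Qed.

(** The gap is filled by the segment from (a, f a) to (b, g b), whose slope [k] is positive because
    f a < g b. *)
Lemma increasing_continuous_link f g (a b : R) :
  increasing_continuous f -> increasing_continuous g ->
  0 < a -> a < b -> f a < g b ->
  exists2 h, increasing_continuous h &
    (forall x, 0 <= x -> x <= a -> h x = f x) /\
    (forall x, b <= x -> h x = g x).
Proof.
move=> fic gic a0 ab fagb.
pose k := (g b - f a) / (b - a).
have ba0 : 0 < b - a by rewrite subr_gt0.
have k0 : 0 < k by rewrite divr_gt0// subr_gt0.
(* A sum of clamped terms instead of a case split, so that continuity is that of a sum: for x >= 0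
   each term varies on only one of [0, a], [a, b], [b, +oo[. The clamps at 0 fit
   [continuous_max0]. *)
pose h x := f (Num.max (Num.min x a) 0) + k * (Num.min (Num.max x a) b - a) +
  (g (Num.max (Num.max x b) 0) - g b).
have b0 : 0 < b by exact: lt_trans ab.
have ha x : 0 <= x -> x <= a -> h x = f x.
  move=> x0 xa; rewrite /h (min_l xa) (max_l x0) (max_r xa) (min_l (ltW ab)).
  rewrite (max_r (le_trans xa (ltW ab))) (max_l (ltW b0)); ring.
have hb x : b <= x -> h x = g x.
  move=> bx; have ax : a <= x by rewrite (le_trans (ltW ab)).
  rewrite /h (min_r ax) (max_l (ltW a0)) (max_l ax) (min_r bx) (max_l bx).
  rewrite (max_l (le_trans (ltW b0) bx)) /k divfK ?gt_eqF//; ring.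
have hm x : a <= x -> x <= b -> h x = f a + k * (x - a).
  move=> ax xb.
  rewrite /h (min_r ax) (max_l (ltW a0)) (max_l ax) (min_l xb) (max_r xb).
  rewrite (max_l (ltW b0)); ring.
have hba : h b = f a + k * (b - a) by rewrite hm// ltW.
have [f0 fi _] := fic; have [g0 gi _] := gic.
have hi x y : 0 <= x -> x < y -> h x < h y.
  move=> x0 xy; have y0 : 0 <= y by rewrite (le_trans x0) ?ltW.
  have kM u v : u < v -> k * u < k * v by rewrite ltr_pM2l.
  case: (leP x a) => xa.
    rewrite (ha x)//; case: (leP y a) => ya; first by rewrite ha// fi.
    have fxa : f x <= f a by exact: increasing_continuous_le.
    case: (leP y b) => yb.
      rewrite hm ?(ltW ya)//; have := kM 0 (y - a).
      rewrite mulr0 subr_gt0 => /(_ ya); lra.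
    have := gi b y (ltW b0) yb; rewrite hb ?(ltW yb)//; lra.
  case: (leP x b) => xb.
    rewrite (hm x) ?(ltW xa)//; case: (leP y b) => yb.
      rewrite hm ?(ltW (lt_trans xa xy))//.
      have := kM (x - a) (y - a); rewrite ltrD2r => /(_ xy); lra.
    have := gi b y (ltW b0) yb; rewrite (hb y) ?(ltW yb)//.
    have : k * (x - a) <= k * (b - a) by rewrite ler_pM2l// lerD2r.
    move: hba; rewrite hb//; lra.
  by rewrite !hb ?(ltW xb)// ?gi// (ltW (lt_trans xb xy)).
exists h => //; split=> // [x x0|].
  have h0 : 0 <= h 0 by rewrite ha ?f0// ltW.
  move: x0; rewrite le_eqVlt => /predU1P[<-//|x0].
  by rewrite (le_trans h0)// ltW// hi.
apply: continuous_subspaceT => x; rewrite /h.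
have minc (u : R -> R) (c : R) : continuous u ->
    continuous (fun y : R => Num.min (u y) c).
  by move=> uc y; apply: continuous_min; [exact: uc|exact: cvg_cst].
have maxc (u : R -> R) (c : R) : continuous u ->
    continuous (fun y : R => Num.max (u y) c).
  by move=> uc y; apply: continuous_max; [exact: uc|exact: cvg_cst].
have idc : continuous (fun y : R => y) by move=> y; exact: cvg_id.
apply: cvgD; first apply: cvgD.
- apply: (@continuous_comp _ _ _ (fun y : R => Num.min y a)
    (fun y : R => f (Num.max y 0))); first exact: minc.
  exact: continuous_max0.
- apply: cvgM; first exact: cvg_cst.
  by apply: cvgB; [exact: (minc _ _ (maxc _ _ idc))|exact: cvg_cst].
- apply: cvgB; last exact: cvg_cst.
  apply: (@continuous_comp _ _ _ (fun y : R => Num.max y b)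
    (fun y : R => g (Num.max y 0))); first exact: maxc.
  exact: continuous_max0.
Qed.

(** * Comparison of the dimensions *)

Lemma smdim_le_truncP (X : metricType R) S n : global_semigroup S ->
  smdim_le X (Trunc_small S) n <-> dim_le (min_metric X) S n.
Proof.
move=> gS; have [Sctrl _ _] := gS; split=> [|[f Sf cov]].
  move=> [g [gctrl [f Sf [a a0 gf]]] [b b0 cov]].
  have [d d0 g1] := small_scale_control_lt _ _ gctrl ltr01.
  (* Up to [r], [g] agrees with [f] ([a]), the covers exist ([b]), g < 1 ([d]), and the scale is
     strictly below 1 (the half). *)
  pose r := Num.min (Num.min a b) (Num.min d (2^-1)).
  have r0 : 0 < r by rewrite !lt_min a0 b0 d0 invr_gt0 ltr0n.
  have [_ [fic _ _]] := Sctrl f Sf.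
  have fr0 := increasing_continuous_gt0 _ _ fic r0.
  (* With 1 <= c * f r, the whole space is an admissible cover at every scale beyond [r]. *)
  have [c c1 cfr] := scale_above f r 1 fr0.
  exists (fun x => c * f x); first exact: global_semigroupZ.
  move=> s s0; case: (leP s r) => sr.
    have := sr; rewrite !le_min => /andP[/andP[sa sb] /andP[sd s2]].
    have fs0 := increasing_continuous_gt0 _ _ fic s0.
    apply: (@has_cover_le _ _ _ s s (g s)) => //.
      by rewrite gf// ler_peMl// ltW.
    apply/has_cover_minP; [|exact: g1|exact: cov].
    by apply: le_lt_trans s2 _; rewrite invf_lt1 ?ltr1n.
  apply: has_cover_setT => x y; rewrite mdist_minE ge_min; apply/orP; right.
  apply: le_trans cfr _; rewrite ler_pM2l ?(lt_le_trans ltr01)//.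
  by apply: increasing_continuous_le; rewrite // ltW.
have [_ fctrl] := Sctrl f Sf.
have [d d0 f1] := small_scale_control_lt _ _ fctrl ltr01.
exists f; first by split=> //; exists f => //; exists 1.
exists (Num.min d 2^-1); first by rewrite lt_min d0 invr_gt0 ltr0n.
move=> s s0; rewrite le_min => /andP[sd s2].
apply/has_cover_minP; [|exact: f1|exact: cov].
by apply: le_lt_trans s2 _; rewrite invf_lt1 ?ltr1n.
Qed.

Lemma asdim_le_truncP (X : metricType R) S n : global_semigroup S ->
  asdim_le X (Trunc_large S) n <-> dim_le (max_metric X) S n.
Proof.
move=> gS; have [Sctrl _ _] := gS; split=> [|[f Sf cov]].
  move=> [g [gctrl [f Sf [a a0 gf]]] [b b0 cov]].
  have [[_ [d d0 fge] _] [fic _ _]] := Sctrl f Sf.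
  (* From [r] on, [g] agrees with [f] ([a]), the covers exist ([b]), f x >= x ([d]), and the
     truncation at 1 is invisible. *)
  pose r := Num.max (Num.max a b) (Num.max d 1).
  have [ra rb rd r1] : [/\ a <= r, b <= r, d <= r & 1 <= r].
    by split; rewrite !le_max lexx ?orbT.
  have f10 := increasing_continuous_gt0 _ _ fic ltr01.
  (* With f r <= c * f 1, the cover of scale [r] serves all scales in [1, r]. *)
  have [c c1 cf1] := scale_above f 1 (f r) f10.
  have c0 : 0 < c by exact: lt_le_trans c1.
  have covr s : r <= s -> has_cover (max_metric X) n s (f s).
    move=> rs; have s1 := le_trans r1 rs; apply/has_cover_maxP => //.
      exact/(le_trans s1)/fge/(le_trans rd).
    by rewrite -gf ?(le_trans ra)//; exact/cov/(le_trans rb).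
  exists (fun x => c * f x); first exact: global_semigroupZ.
  move=> s s0; have fs0 := increasing_continuous_gt0 _ _ fic s0.
  case: (ltP s 1) => s1.
    apply: (@has_cover_singletons _ _ _ _ 1) => //; last first.
      by rewrite mulr_ge0// ltW.
    by move=> x y /eqP xy; rewrite mdist_maxE (negbTE xy) le_max lexx orbT.
  case: (leP s r) => sr.
    apply: has_cover_le (covr r _) => //; apply: le_trans cf1 _.
    by rewrite ler_pM2l//; exact: increasing_continuous_le.
  apply: has_cover_le (covr s _) => //; last exact: ltW.
  by rewrite ler_peMl// ltW.
have [fctrl _] := Sctrl f Sf; have [_ [d d0 fge] _] := fctrl.
exists f; first by split=> //; exists f => //; exists 1.
exists (Num.max d 1); first by rewrite lt_max d0.
move=> s; rewrite ge_max => /andP[ds s1].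
apply/has_cover_maxP => //; first exact/(le_trans s1)/fge.
exact/cov/(lt_le_trans _ s1).
Qed.

Lemma dim_le_LinkP (X : metricType R) xi S n :
  small_scale_semigroup xi -> large_scale_semigroup S ->
  dim_le X (Link xi S) n <-> smdim_le X xi n /\ asdim_le X S n.
Proof.
move=> sxi lS; have [xictrl _ _] := sxi; have [Sctrl _ _] := lS; split.
  move=> [h [_ [f xif [a a0 hf]] [g Sg [b b0 hg]]] cov]; split.
    by exists f => //; exists a => // s s0 sa; rewrite -hf//; exact: cov.
  exists g => //; exists b => // s bs; rewrite -hg//.
  exact/cov/(lt_le_trans b0).
move=> [[f xif [a a0 covf]] [g Sg [b0 b00 covg]]].
have [fic _ _] := xictrl f xif; have [gic _ _] := Sctrl g Sg.
pose b := Num.max b0 (a + 1).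
have b0b : b0 <= b by rewrite le_max lexx.
have ab : a < b by rewrite lt_max ltrDl ltr01 orbT.
have bp : 0 < b by exact: lt_trans ab.
have gb0 := increasing_continuous_gt0 _ _ gic bp.
have fa0 := increasing_continuous_gt0 _ _ fic a0.
(* [c] is chosen against the unscaled [g b], the bound of the cover at scale [b]. Only then does
   [c'] lift [g] strictly above c * f a at [b], as the interpolation requires. *)
have [c c1 cfa] := scale_above f a (g b) fa0.
have [c' c'1 c'gb] := scale_above g b (c * f a + 1) gb0.
have xicf := small_scale_semigroupZ _ _ _ sxi c1 xif.
have Scg := large_scale_semigroupZ _ _ _ lS c'1 Sg.
have [cfic _ _] := xictrl _ xicf; have [cgic _ _] := Sctrl _ Scg.
have [|h hic [hf hg]] := increasing_continuous_link _ _ _ _ cfic cgic a0 ab.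
  by apply: lt_le_trans c'gb; rewrite ltrDl.
exists h.
  split=> //.
    by exists (fun x => c * f x) => //; exists a => // s /ltW; exact: hf.
  by exists (fun x => c' * g x) => //; exists b.
move=> s s0; case: (leP s a) => sa.
  apply: has_cover_le (covf s s0 sa) => //; rewrite hf ?(ltW s0)//.
  by rewrite ler_peMl// ltW//; exact: increasing_continuous_gt0.
case: (leP b s) => bs.
  apply: has_cover_le (covg s _) => //; last exact: le_trans bs.
  by rewrite hg// ler_peMl// ltW//; exact: increasing_continuous_gt0.
(* For a < s < b the cover of scale [b] is used: g b <= c * f a = h a <= h s. *)
apply: has_cover_le (covg b _) => //; first exact: ltW.
rewrite (le_trans cfa)// -(hf a) ?(ltW a0)//.
by apply: increasing_continuous_le => //; exact: ltW.
Qed.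

End control_functions.

Theorem theorem4p11 (R : realType) :
  (forall S : set (R -> R), global_semigroup S ->
     forall X : metricType R,
       smdim X (Trunc_small S) = m_dim X S /\
       asdim X (Trunc_large S) = M_dim X S) /\
  (forall xi S : set (R -> R),
     small_scale_semigroup xi -> large_scale_semigroup S ->
     forall X : metricType R,
       control_dim X (Link xi S) = maxe (smdim X xi) (asdim X S)).
Proof.
split=> [S gS X|xi S sxi lS X].
  split; apply: least_nat_ext => n; first exact: smdim_le_truncP.
  exact: asdim_le_truncP.
rewrite -least_nat_setI.
- by apply: least_nat_ext => n; exact: dim_le_LinkP.
- exact: smdim_le_up.
- exact: asdim_le_up.
Qed.
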